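(* For the $n$-dimensional Chaplygin sphere that rolls without slipping on a hyperplane that steadily rotates with angular velocity $\eta\in\mathfrak{so}(n)$, $\eta e_n=0$, let $Y_\eta$ be the vector field with left-trivialized components $Y_\eta(x,g)=(\eta x,0)$ (the infinitesimal generator associated to $\eta$ of the action $h\cdot(x,g)=(\tilde hx,g)$ of $\mathrm{SO}(n-1)$). Then $$E_{L,Y_\eta}|_M(x,g,\dot x,\Omega)=\frac12\langle K,\Omega\rangle-\frac m2\|\eta x\|^2,$$ where $K=\mathbb{I}\Omega+mr^2\big(\Gamma(g)\Omega+\Omega\Gamma(g)\big)\in\mathfrak{so}(n)$.
   Context: $x\in\mathbb{R}^n$ is the position of the center of mass (equal to the geometric center) of an $n$-dimensional sphere of radius $r>0$ and mass $m>0$ in an inertial frame $\{O;e_1,\dots,e_n\}$. The sphere rolls on the hyperplane through $O$ with normal vector $e_n$, so $x_n=r$ at all times. The configuration space is $Q=\mathbb{R}^{n-1}\times\mathrm{SO}(n)$, embedded in $\mathbb{R}^n\times\mathrm{SO}(n)\ni(x,g)$ by $x_n=r$; $TQ$ is embedded in $T(\mathbb{R}^n\times\mathrm{SO}(n))$ by $x_n=r$, $\dot x_n=0$. $T\mathrm{SO}(n)$ is left-trivialized by $\Omega=g^{-1}\dot g\in\mathfrak{so}(n)$; $\omega=\dot gg^{-1}=\mathrm{Ad}_g\Omega$. $\langle\zeta_1,\zeta_2\rangle=-\frac12\mathrm{Trace}(\zeta_1\zeta_2)$ on $\mathfrak{so}(n)$; the inertia tensor $\mathbb{I}:\mathfrak{so}(n)\to\mathfrak{so}(n)$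 is a positive definite symmetric linear operator. The Lagrangian is $L(x,g,\dot x,\Omega)=\frac12\langle\mathbb{I}\Omega,\Omega\rangle+\frac m2\|\dot x\|^2$. The element $\eta\in\mathfrak{so}(n)$ is fixed, with $\eta e_n=0$, so it may be regarded as an element of $\mathfrak{so}(n-1)$ (upper-left block). The nonholonomic constraint of rolling without slipping is $\dot x=r\omega e_n+\eta x=r(\mathrm{Ad}_g\Omega)e_n+\eta x$, which defines the constraint manifold $M\subset TQ$. For $h\in\mathrm{SO}(n-1)$, $\tilde h=\begin{pmatrix}h&0\\0&1\end{pmatrix}\in\mathrm{SO}(n)$. $\gamma=\gamma(g)=g^{-1}e_n$ is the Poisson vector and $\Gamma=\Gamma(g)=\gamma\gamma^T$. $p$ is the momentum 1-form generated by $L$ (the derivative of $L$ with respect to the velocities), $E_L=\langle p,\cdot\rangle-L$ (with cotangent-tangent pairing), and for a vector field $Y$ on $Q$, $E_{L,Y}=E_L-\langle p,Y\rangle$, as functions on $TQ$. *)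

(* Defs.v *)
From HB Require Import structures.
From mathcomp Require Import all_boot all_order all_algebra.
From mathcomp Require Import all_classical all_reals all_analysis.

Set Implicit Arguments.
Unset Strict Implicit.
Unset Printing Implicit Defensive.

Import Order.TTheory GRing.Theory Num.Theory.
Import numFieldNormedType.Exports.

Local Open Scope classical_set_scope.
Local Open Scope ring_scope.

(* The ambient dimension is written [d + 1], so that R^(n-1) x R and the
   upper-left embedding of SO(n-1) in SO(n) are the library's block matrices. *)

Definition so (R : realType) (n : nat) : set 'M[R]_n := [set A | A^T = - A].

Definition SO (R : realType) (n : nat) : set 'M[R]_n :=
  [set g | g^T *m g = 1%:M /\ \det g = 1].

Definition e_last (R : realType) (d : nat) : 'cV[R]_(d + 1) :=
  delta_mx (rshift d ord0) ord0.

(* The library's [`|x|] on matrices is the sup norm; the Euclidean structure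
   has to be written out. *)
Definition dot (R : realType) (n : nat) (x y : 'cV[R]_n) : R :=
  \sum_i x i ord0 * y i ord0.

Definition sqnorm (R : realType) (n : nat) (x : 'cV[R]_n) : R := dot x x.

Definition so_ip (R : realType) (n : nat) (A B : 'M[R]_n) : R :=
  - (1 / 2) * \tr (A *m B).

Definition Ad (R : realType) (n : nat) (g Omega : 'M[R]_n) : 'M[R]_n :=
  g *m Omega *m invmx g.

(* [I] is a function on all matrices, but only its restriction to so(n) is
   constrained, and only that restriction is meaningful. *)
Record inertia_tensor (R : realType) (n : nat) (I : 'M[R]_n -> 'M[R]_n) : Prop :=
  InertiaTensor {
    inertia_so : forall A, so A -> so (I A) ;
    inertia_linear : forall (a : R) A B, so A -> so B ->
      I (a *: A + B) = a *: I A + I B ;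
    inertia_sym : forall A B, so A -> so B -> so_ip (I A) B = so_ip A (I B) ;
    inertia_posdef : forall A, so A -> A != 0 -> 0 < so_ip (I A) A
  }.

(* A configuration is (x, g); a left-trivialized tangent vector at (x, g) is
   (x', Omega), standing for (x', g Omega) in the ambient space. *)
Notation conf R d := ('cV[R]_(d + 1) * 'M[R]_(d + 1))%type (only parsing).
Notation vel R d := ('cV[R]_(d + 1) * 'M[R]_(d + 1))%type (only parsing).

Definition Qconf (R : realType) (d : nat) (r : R) : set (conf R d) :=
  [set q : conf R d | q.1 (rshift d ord0) ord0 = r /\ SO q.2].

Definition TQ (R : realType) (d : nat) (r : R) : set (conf R d * vel R d) :=
  [set s : conf R d * vel R d | Qconf r s.1 /\ s.2.1 (rshift d ord0) ord0 = 0 /\ so s.2.2].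

Section Mechanics.
Context {R : realType} {d : nat}.
Implicit Types (q : conf R d) (v w : vel R d).
Implicit Types (L : conf R d -> vel R d -> R) (Y : conf R d -> vel R d).

(* [momentum L q v w] is the pairing <p, w> at the point (q, v): the fibre
   derivative of L.  For v, w tangent to Q the line v + t w stays in the tangent
   space, so only the values of L on TQ matter. *)
Definition momentum L q v w : R :=
  'D_w (L q) v.

Definition energy L q v : R := momentum L q v v - L q v.

Definition moving_energy L Y q v : R := energy L q v - momentum L q v (Y q).

Definition chaplygin_L (m : R) (I : 'M[R]_(d + 1) -> 'M[R]_(d + 1)) q v : R :=
  1 / 2 * so_ip (I v.2) v.2 + m / 2 * sqnorm v.1.

Definition rolling (r : R) (eta : 'M[R]_(d + 1)) : set (conf R d * vel R d) :=
  [set s : conf R d * vel R d | TQ r s /\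
    s.2.1 = r *: (Ad s.1.2 s.2.2 *m e_last R d) + eta *m s.1.1].

Definition Y_rot (eta : 'M[R]_(d + 1)) q : vel R d := (eta *m q.1, 0).

Definition poisson (g : 'M[R]_(d + 1)) : 'cV[R]_(d + 1) :=
  invmx g *m e_last R d.

Definition Gam (g : 'M[R]_(d + 1)) : 'M[R]_(d + 1) :=
  poisson g *m (poisson g)^T.

Definition Kmom (m r : R) (I : 'M[R]_(d + 1) -> 'M[R]_(d + 1))
    (g Omega : 'M[R]_(d + 1)) : 'M[R]_(d + 1) :=
  I Omega + (m * r ^+ 2) *: (Gam g *m Omega + Omega *m Gam g).

(* The limit is in the library's topology on matrices (entrywise). *)
Definition expmx (n : nat) (A : 'M[R]_n) : 'M[R]_n :=
  limn (series (fun k => (k`!%:R)^-1 *: A ^+ k)).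

Definition rot_act (h : 'M[R]_d) q : conf R d :=
  (block_mx h 0 0 (1%:M : 'M[R]_1) *m q.1, q.2).

(* ((Y q).1, g (Y q).2) is the ambient vector with left-trivialized components
   Y q. *)
Definition infinitesimal_generator (r : R)
    (act : 'M[R]_d -> conf R d -> conf R d) (xi : 'M[R]_d) Y : Prop :=
  forall q, Qconf r q ->
    is_derive (0 : R) 1
      (fun t : R => act (expmx (t *: xi)) q)
      ((Y q).1, q.2 *m (Y q).2).

End Mechanics.

(* Main.v *)
Require Import Defs.
From HB Require Import structures.
From mathcomp Require Import all_boot all_order all_algebra.
From mathcomp Require Import all_classical all_reals all_analysis.
From mathcomp Require Import ring.

Set Implicit Arguments.
Unset Strict Implicit.
Unset Printing Implicit Defensive.

Import Order.TTheory GRing.Theory Num.Theory.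
Import numFieldNormedType.Exports.

Local Open Scope classical_set_scope.
Local Open Scope ring_scope.

(** Both assertions reduce to short computations once the two derivatives in
    the definitions are evaluated.

    The generator.  The orbit of (x, g) is t |-> (exp~(t xi) x, g) with xi the
    upper-left block of eta, so its velocity at 0 is (xi~ x, 0), where xi~ is xi
    padded by zeros.  Skew-symmetry and eta e_n = 0 make the last column and the
    last row of eta vanish, whence xi~ = eta ([so_e_last_block]).  What needs
    analysis is the derivative of t |-> exp(t A) at 0 ([is_derive_expmx0]): each
    entry is a power series in t whose k-th coefficient is (A^k)_ij / k!, of
    infinite radius of convergence because |(A^k)_ij| grows at most
    geometrically, and its linear coefficient is A_ij.

    The moving energy.  L is quadratic in the velocities, so
    <p, (w, W)> = <I Omega, W> + m (x', w) ([momentum_chaplygin]), and for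
    Y = (eta x, 0) completing the square gives
      E_L - <p, Y> = <I Omega, Omega> / 2 + m |x'|^2 / 2 - m (x', eta x)
                   = <I Omega, Omega> / 2 + m |x' - eta x|^2 / 2
                     - m |eta x|^2 / 2.
    On the constraint x' - eta x = r g Omega gamma, whose square norm is
    r^2 |Omega gamma|^2 since g is orthogonal.  Finally
    |Omega gamma|^2 = <Gamma Omega + Omega Gamma, Omega>
    ([so_ip_anticomm_rank1]), which turns the middle term into the second
    summand of K. *)

(** * Derivatives of matrix-valued functions *)

Lemma cvg_mx_coord (R : realType) (T : Type) (F : set_system T) (FF : Filter F)
    (m n : nat) (f : T -> 'M[R]_(m, n)) (L : 'M[R]_(m, n)) :
  (forall i j, f x i j @[x --> F] --> L i j) -> f x @[x --> F] --> L.
Proof.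
move=> fL; apply/cvgrPdist_le => e e0.
near=> x.
rewrite /Num.Def.normr/= mx_normrE (bigmax_le _ (ltW e0))//= => i _.
rewrite !mxE/=.
move: i; near: x; apply: filter_forall => /= i.
exact: ((cvgrPdist_le _ _).1 (fL i.1 i.2)).
Unshelve. all: by end_near. Qed.

Lemma is_derive_mx (R : realType) (V : normedModType R) (m n : nat)
    (f : V -> 'M[R]_(m, n)) (D : 'M[R]_(m, n)) (t v : V) :
  (forall i j, is_derive t v (fun x => f x i j) (D i j)) -> is_derive t v f D.
Proof.
move=> fD; have df : derivable f t v by apply/derivable_mxP => i j; case: (fD i j).
apply: DeriveDef => //; rewrite derive_mx//.
by apply/matrixP => i j; rewrite mxE; case: (fD i j).
Qed.

Lemma is_derive_coord (R : realType) (V : normedModType R) (m n : nat)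
    (f : V -> 'M[R]_(m, n)) (D : 'M[R]_(m, n)) (t v : V) i j :
  is_derive t v f D -> is_derive t v (fun x => f x i j) (D i j).
Proof.
case=> df <-; rewrite derive_mx// mxE; apply/derivableP.
exact: (derivable_mxP _ _ _).1.
Qed.

Lemma is_derive_mulmxr (R : realType) (V : normedModType R) (m n p : nat)
    (f : V -> 'M[R]_(m, n)) (D : 'M[R]_(m, n)) (B : 'M[R]_(n, p)) (t v : V) :
  is_derive t v f D -> is_derive t v (fun x => f x *m B) (D *m B).
Proof.
move=> fD; apply: is_derive_mx => i j.
have -> : (fun x => (f x *m B) i j) = \sum_k (fun x => B k j *: f x i k).
  by apply/funext => x; rewrite fct_sumE mxE; apply: eq_bigr => k _; exact: mulrC.
have -> : (D *m B) i j = \sum_k B k j *: D i k.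
  by rewrite mxE; apply: eq_bigr => k _; exact: mulrC.
apply: is_derive_sum => k.
exact/is_deriveZ/is_derive_coord.
Qed.

Lemma is_derive_block_mx_ul (R : realType) (V : normedModType R) (m1 m2 n1 n2 : nat)
    (f : V -> 'M[R]_(m1, n1)) (D : 'M[R]_(m1, n1))
    (B : 'M[R]_(m1, n2)) (C : 'M[R]_(m2, n1)) (E : 'M[R]_(m2, n2)) (t v : V) :
  is_derive t v f D ->
  is_derive t v (fun x => block_mx (f x) B C E) (block_mx D 0 0 0).
Proof.
move=> fD; apply: is_derive_mx => i j.
case: (split_ordP i) => i' ->; case: (split_ordP j) => j' ->.
- rewrite block_mxEul (_ : (fun _ => _) = fun x => f x i' j').
    exact: is_derive_coord.
  by apply/funext => x; rewrite block_mxEul.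
- rewrite block_mxEur mxE (_ : (fun _ => _) = cst (B i' j')).
    exact: is_derive_cst.
  by apply/funext => x; rewrite block_mxEur.
- rewrite block_mxEdl mxE (_ : (fun _ => _) = cst (C i' j')).
    exact: is_derive_cst.
  by apply/funext => x; rewrite block_mxEdl.
- rewrite block_mxEdr mxE (_ : (fun _ => _) = cst (E i' j')).
    exact: is_derive_cst.
  by apply/funext => x; rewrite block_mxEdr.
Qed.

(** Stated with a constant second component because the action leaves the
    rotation g of the sphere unchanged. *)
Lemma is_derive_pairl (R : realType) (U V W : normedModType R)
    (f : U -> V) (df : V) (c : W) (x v : U) :
  is_derive x v f df -> is_derive x v (fun t => (f t, c)) (df, 0).
Proof.
case=> cf ef.
have H : h^-1 *: ((f (h *: v + x), c) - (f x, c)) @[h --> 0^'] --> (df, 0 : W).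
  have -> : (fun h : R => h^-1 *: ((f (h *: v + x), c) - (f x, c))) =
      (fun h : R => (h^-1 *: (f (h *: v + x) - f x), 0 : W)).
    by apply/funext => h; congr (_, _); rewrite /= subrr scaler0.
  apply: cvg_pair; last exact: cvg_cst.
  by rewrite -ef; exact: cf.
apply: DeriveDef; last exact: cvg_lim H.
by apply: cvgP; exact: H.
Qed.

(** * The matrix exponential at the origin *)

(** Each entry of a product of two n x n matrices is a sum of n products, so
    passing from A^k to A^(k+1) costs at most a factor n c. *)
Lemma coord_exprmx_le (R : realType) (n : nat) (A : 'M[R]_n) (c : R) k i j :
  (forall i j, `|A i j| <= c) -> `|(A ^+ k) i j| <= (n%:R * c) ^+ k.
Proof.
move=> Ac; elim: k i j => [|k IH] i j.
  by rewrite !expr0 mxE normr_nat; case: (i == j); rewrite /= ?ler01.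
rewrite !exprS mxE.
apply: (le_trans (ler_norm_sum _ _ _)).
apply: (@le_trans _ _ (\sum_(l < n) c * (n%:R * c) ^+ k)).
  by apply: ler_sum => l _; rewrite normrM; apply: ler_pM.
by rewrite sumr_const card_ord mulr_natl -mulrnAl.
Qed.

(** Comparison with C exp(B |x|).  The constant C lets the bound survive the
    index shifts that differentiating the series produces. *)
Lemma is_cvg_pseries_fact (R : realType) (u : R^nat) (C B x : R) :
  0 <= C -> 0 <= B ->
  (forall k, `|u k| <= C * B ^+ k) -> cvgn (pseries (fun k => u k / k`!%:R) x).
Proof.
move=> C0 B0 uB; apply: normed_cvg.
apply: (@series_le_cvg _ _ (C *: exp_coeff (B * `|x|))).
- by move=> k /=.
- move=> k; rewrite /= mulr_ge0// exp_coeff_ge0// mulr_ge0//.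
- move=> k; rewrite -[leRHS]/(C * ((B * `|x|) ^+ k / k`!%:R)) /=.
  rewrite !normrM normrX normfV normr_nat exprMn mulrAC !mulrA.
  by rewrite ler_wpM2r// ler_wpM2r// exprn_ge0.
- by apply: is_cvg_seriesZ; exact: is_cvg_series_exp_coeff.
Qed.

Lemma limn_pseries0 (R : realType) (f : R^nat) : limn (pseries f 0) = f 0%N.
Proof.
apply: lim_near_cst => //; near=> n.
rewrite /pseries /series /= -[n]prednK; last by near: n; exists 1%N.
rewrite big_nat_recl// expr0 mulr1 big1 ?addr0// => i _.
by rewrite exprS mul0r mulr0.
Unshelve. all: by end_near. Qed.

(** For exponential generating series differentiation is the shift of the
    coefficients, so their convergence is inherited by all derivatives. *)
Lemma pseries_diffs_fact (R : realType) (u : R^nat) :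
  pseries_diffs (fun k => u k / k`!%:R) = (fun k => u k.+1 / k`!%:R).
Proof.
apply/funext => k; rewrite /pseries_diffs factS natrM invfM.
by rewrite mulrCA mulVKf.
Qed.

Lemma exprmxZ (R : comPzRingType) (n : nat) (t : R) (A : 'M[R]_n) k :
  (t *: A) ^+ k = t ^+ k *: A ^+ k.
Proof.
elim: k => [|k IH]; first by rewrite !expr0 scale1r.
by rewrite !exprS IH -!mulmxE -scalemxAl -scalemxAr scalerA.
Qed.

(** Entry (i, j) of exp(t A) is the exponential generating series in t of
    k |-> (A^k)_ij; term-by-term differentiation leaves A_ij at t = 0. *)
Lemma is_derive_expmx0 (R : realType) (n : nat) (A : 'M[R]_n) :
  is_derive (0 : R) 1 (fun t : R => expmx (t *: A)) A.
Proof.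
pose c := mx_norm A.
have Ac i j : `|A i j| <= c.
  by rewrite /c mx_normrE; exact: (le_bigmax _ _ (i, j)).
have c0 : 0 <= c by rewrite /c mx_normE.
pose B := n%:R * c.
have B0 : 0 <= B by rewrite mulr_ge0.
pose u i j : R^nat := fun k => (A ^+ k) i j.
(* The shifts s = 0, 1, 2 are the series and its first two derivatives, the
   three convergences that term-by-term differentiation asks for. *)
have cvgu s i j x : cvgn (pseries (fun k => u i j (k + s)%N / k`!%:R) x).
  apply: (@is_cvg_pseries_fact _ _ (B ^+ s) B) => //; first exact: exprn_ge0.
  by move=> k; rewrite mulrC -exprD; exact: coord_exprmx_le.
have expE t : expmx (t *: A) =
    \matrix_(i, j) limn (pseries (fun k => u i j k / k`!%:R) t).
  apply: cvg_lim => //; apply: cvg_mx_coord => i j; rewrite mxE.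
  suff -> : (fun N => series (fun k => k`!%:R^-1 *: (t *: A) ^+ k) N i j) =
      pseries (fun k => u i j k / k`!%:R) t.
    by have := cvgu 0%N i j t; under eq_fun do rewrite addn0.
  apply/funext => N; rewrite /pseries /series/= summxE; apply: eq_bigr => k _.
  by rewrite exprmxZ scalerA mxE/= /u mulrC mulrA mulrAC.
rewrite (_ : (fun _ => _) = fun t => \matrix_(i, j)
    limn (pseries (fun k => u i j k / k`!%:R) t)); last exact/funext.
apply: is_derive_mx => i j; under eq_fun do rewrite mxE.
have -> : A i j = limn (pseries (pseries_diffs (fun k => u i j k / k`!%:R)) 0).
  by rewrite limn_pseries0 pseries_diffs_fact fact0 divr1 /u expr1.
(* Any radius larger than |0| would do in place of 1. *)
apply: (@pseries_snd_diffs _ _ 1); last by rewrite normr0 normr1.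
- by have := cvgu 0%N i j 1; under eq_fun do rewrite addn0.
- by rewrite pseries_diffs_fact; have := cvgu 1%N i j 1; under eq_fun do rewrite addn1.
- rewrite !pseries_diffs_fact; have := cvgu 2%N i j 1.
  by under eq_fun do rewrite addn2.
Qed.

(** * The Euclidean structures *)

(** Written as a trace, the dot product can be rearranged by cyclicity. *)
Lemma dot_trE (R : realType) (n : nat) (x y : 'cV[R]_n) :
  dot x y = \tr (x^T *m y).
Proof.
rewrite /mxtrace big_ord1 mxE; apply: eq_bigr => i _.
by rewrite mxE ord1.
Qed.

Lemma dotC (R : realType) (n : nat) (x y : 'cV[R]_n) : dot x y = dot y x.
Proof. by apply: eq_bigr => i _; rewrite mulrC. Qed.

Lemma dotDZl (R : realType) (n : nat) (h : R) (x y z : 'cV[R]_n) :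
  dot (h *: x + y) z = h * dot x z + dot y z.
Proof.
by rewrite !dot_trE linearP mulmxDl -scalemxAl mxtraceD mxtraceZ.
Qed.

Lemma sqnormZ (R : realType) (n : nat) (a : R) (x : 'cV[R]_n) :
  sqnorm (a *: x) = a ^+ 2 * sqnorm x.
Proof.
by rewrite /sqnorm /dot mulr_sumr; apply: eq_bigr => i _; rewrite !mxE; ring.
Qed.

Lemma sqnormB (R : realType) (n : nat) (x y : 'cV[R]_n) :
  sqnorm (x - y) = sqnorm x - 2 * dot x y + sqnorm y.
Proof.
rewrite /sqnorm addrC -scaleN1r dotDZl !(dotC _ (-1 *: _ + _)) !dotDZl.
by rewrite (dotC y x); ring.
Qed.

Lemma so_ipDZl (R : realType) (n : nat) (h : R) (A B C : 'M[R]_n) :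
  so_ip (h *: A + B) C = h * so_ip A C + so_ip B C.
Proof.
by rewrite /so_ip mulmxDl -scalemxAl mxtraceD mxtraceZ; ring.
Qed.

Lemma so_ipC (R : realType) (n : nat) (A B : 'M[R]_n) : so_ip A B = so_ip B A.
Proof. by rewrite /so_ip mxtrace_mulC. Qed.

(** Keeps the lines along which the Lagrangian is differentiated inside so(n),
    the only place where the inertia tensor is known to be linear. *)
Lemma so_line (R : realType) (n : nat) (h : R) (A B : 'M[R]_n) :
  so A -> so B -> so (h *: A + B).
Proof. by rewrite /so /= => sA sB; rewrite linearP /= sA sB scalerN opprD. Qed.

(** * Momentum of the Chaplygin sphere *)

(** The inertia tensor is controlled only on so(n), so the Lagrangian need not be
    differentiable on the whole velocity space; the directional derivative is
    therefore read off from the restriction to a single line. *)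
Lemma derive_quadratic (R : realType) (V : normedModType R) (f : V -> R)
    (v w : V) (b c : R) :
  (forall h, f (h *: w + v) = f v + h * b + h ^+ 2 * c) -> 'D_w f v = b.
Proof.
move=> fE; apply: cvg_lim => //=.
have H : b + h * c @[h --> 0^'] --> b.
  rewrite -[X in _ --> X]addr0 -[X in _ --> _ + X](mul0r c).
  apply: cvgD; first exact: cvg_cst.
  apply: cvgMl; exact: cvg_within.
apply: cvg_trans H; apply: near_eq_cvg; near=> h.
rewrite /= fE /GRing.scale/=.
have h0 : h != 0 by near: h; exact: nbhs_dnbhs_neq.
by field.
Unshelve. all: by end_near. Qed.

(** Polarization of the kinetic energy: the two cross terms of
    L (v + h w) agree because I and the dot product are symmetric, which
    cancels the factors 1/2. *)
Lemma momentum_chaplygin (R : realType) (d : nat) (m : R)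
    (I : 'M[R]_(d + 1) -> 'M[R]_(d + 1)) q v w (HI : inertia_tensor I) :
  so v.2 -> so w.2 ->
  momentum (chaplygin_L m I) q v w = so_ip (I v.2) w.2 + m * dot v.1 w.1.
Proof.
move=> sv sw; apply: (derive_quadratic
  (c := 1 / 2 * so_ip (I w.2) w.2 + m / 2 * sqnorm w.1)) => h.
rewrite /chaplygin_L /sqnorm /= (inertia_linear HI)//.
rewrite so_ipDZl (so_ipC (I w.2)) (so_ipC (I v.2)) !so_ipDZl.
rewrite dotDZl ![dot _ (h *: _ + _)]dotC !dotDZl.
rewrite -(so_ipC v.2) -(so_ipC w.2).
rewrite (dotC w.1 v.1) [so_ip v.2 (I w.2)]so_ipC (inertia_sym HI)// (so_ipC w.2).
by field.
Qed.

(** * Kinematics of rolling *)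

Lemma sqnorm_SO (R : realType) (n : nat) (g : 'M[R]_n) (x : 'cV[R]_n) :
  SO g -> sqnorm (g *m x) = sqnorm x.
Proof.
by case=> gg _; rewrite /sqnorm !dot_trE trmx_mul mulmxA -(mulmxA x^T) gg mulmx1.
Qed.

Lemma Gam_tr (R : realType) (d : nat) (g : 'M[R]_(d + 1)) : (Gam g)^T = Gam g.
Proof. by rewrite /Gam trmx_mul trmxK. Qed.

Lemma so_anticomm (R : realType) (n : nat) (S Omega : 'M[R]_n) :
  S^T = S -> so Omega -> so (S *m Omega + Omega *m S).
Proof.
rewrite /so /= => sS sO.
by rewrite linearD /= !trmx_mul sS sO mulmxN mulNmx -opprD addrC.
Qed.

(** By cyclicity of the trace both summands of the anticommutator contribute
    - c^T Omega^2 c / 2, and Omega^T = - Omega makes - c^T Omega^2 c the square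
    norm of Omega c. *)
Lemma so_ip_anticomm_rank1 (R : realType) (n : nat) (c : 'cV[R]_n) (Omega : 'M[R]_n) :
  so Omega ->
  so_ip (c *m c^T *m Omega + Omega *m (c *m c^T)) Omega = sqnorm (Omega *m c).
Proof.
rewrite /so /= => sO.
rewrite /so_ip mulmxDl linearD /= -(mulmxA Omega) [\tr (Omega *m _)]mxtrace_mulC.
rewrite -!mulmxA mxtrace_mulC /sqnorm dot_trE trmx_mul sO mulmxN mulNmx linearN /=.
rewrite !mulmxA.
by field.
Qed.

(** The last column of eta is eta e_n = 0, and skew-symmetry carries this over to
    the last row. *)
Lemma so_e_last_block (R : realType) (d : nat) (eta : 'M[R]_(d + 1)) :
  so eta -> eta *m e_last R d = 0 -> eta = block_mx (ulsubmx eta) 0 0 0.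
Proof.
rewrite /so /= => seta etae.
have col0 i : eta i (rshift d ord0) = 0.
  by have /matrixP/(_ i ord0) := etae; rewrite -colE !mxE.
have row0 j : eta (rshift d ord0) j = 0.
  have /matrixP/(_ j (rshift d ord0)) := seta.
  by rewrite !mxE col0 oppr0.
rewrite -[LHS]submxK; congr block_mx; apply/matrixP => i j; rewrite !mxE.
- by rewrite ord1 col0.
- by rewrite ord1 row0.
- by rewrite ord1 row0.
Qed.

(** * The moving energy *)

Theorem proposition17 (R : realType) (d : nat) (r m : R)
    (I : 'M[R]_(d + 1) -> 'M[R]_(d + 1)) (eta : 'M[R]_(d + 1))
    (r_gt0 : 0 < r) (m_gt0 : 0 < m) (HI : inertia_tensor I)
    (eta_so : so eta) (eta_e : eta *m e_last R d = 0) :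
  infinitesimal_generator r rot_act (ulsubmx eta) (Y_rot eta) /\
  forall (x : 'cV[R]_(d + 1)) (g : 'M[R]_(d + 1))
         (xdot : 'cV[R]_(d + 1)) (Omega : 'M[R]_(d + 1)),
    rolling r eta ((x, g), (xdot, Omega)) ->
    so (Kmom m r I g Omega) /\
    moving_energy (chaplygin_L m I) (Y_rot eta) (x, g) (xdot, Omega) =
      1 / 2 * so_ip (Kmom m r I g Omega) Omega - m / 2 * sqnorm (eta *m x).
Proof.
split=> [[x g] _ /=|x g xdot Omega [/= [[/= _ sg] [_ sO]] xdotE]].
  rewrite mulmx0 [in eta *m x](so_e_last_block eta_so eta_e).
  apply: is_derive_pairl; apply: is_derive_mulmxr.
  exact/is_derive_block_mx_ul/is_derive_expmx0.
split.
  rewrite /Kmom addrC; apply: so_line; last exact: inertia_so.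
  by apply: so_anticomm => //; exact: Gam_tr.
(* The velocity relative to the table is r g Omega gamma, and g is an
   isometry. *)
have relE : sqnorm (xdot - eta *m x) = r ^+ 2 * sqnorm (Omega *m poisson g).
  by rewrite xdotE addrK sqnormZ /Ad -!mulmxA -/(poisson g) (sqnorm_SO _ sg).
rewrite /moving_energy /energy !momentum_chaplygin//=; last first.
  by rewrite /so /= trmx0 oppr0.
rewrite /chaplygin_L /Kmom /= [I Omega + _]addrC so_ipDZl so_ip_anticomm_rank1//.
rewrite -(mulrA m (r ^+ 2)) -relE.
rewrite sqnormB /so_ip mulmx0 linear0 /sqnorm.
by field.
Qed.
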